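(* Let $I$ be an index set. Any $A\in\mathrm{B}(\ell^2_I)$ induces a completely bounded Schur multiplier $M_A\colon S^1_I\to\mathrm{B}(\ell^2_I)$ and we have $$\|M_A\|_{\mathrm{cb},S^1_I\to\mathrm{B}(\ell^2_I)}=\|A\|_{\mathrm{B}(\ell^2_I)}.$$
   Context: $S^1_I$ is the Schatten trace class on $\ell^2_I$, with operators identified with their matrices $[b_{ij}]_{i,j\in I}$ in the canonical basis, and $(e_{ij})$ the matrix units. For $A=[a_{ij}]$, the Schur multiplier is $M_A([b_{ij}])=[a_{ij}b_{ij}]$. The operator space structure on $S^1_I$ is that of the predual of $\mathrm{B}(\ell^2_I)$ for the duality bracket $\langle e_{ij},e_{kl}\rangle=\delta_{i=k}\delta_{j=l}$, i.e. $\langle A,B\rangle=\sum_{i,j}a_{ij}b_{ij}$. *)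

(* Defs.v *)
From HB Require Import structures.
From mathcomp Require Import all_boot all_order all_algebra.
From mathcomp Require Import complex.
From mathcomp Require Import all_classical all_reals all_analysis.
From mathcomp Require Import summability.
From mathcomp Require Import ring.

Set Implicit Arguments.
Unset Strict Implicit.
Unset Printing Implicit Defensive.

Import Order.TTheory GRing.Theory Num.Theory.
Import numFieldNormedType.Exports.

Local Open Scope classical_set_scope.
Local Open Scope ring_scope.

(* The library norm `|z| of z : R[i] lives in R[i]; this is its value in R. *)
Definition modulus (R : rcfType) (z : R[i]) : R := complex.Re `|z|.

Lemma modulusE (R : rcfType) (z : R[i]) : `|z| = (modulus z)%:C%C.
Proof. by rewrite /modulus; case: z. Qed.

Lemma modulus_ge0 (R : rcfType) (z : R[i]) : 0 <= modulus z.
Proof. by have := normr_ge0 z; rewrite modulusE lecE /= => /andP[]. Qed.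

Lemma modulusD (R : rcfType) (y z : R[i]) :
  modulus (y + z) <= modulus y + modulus z.
Proof.
by have := ler_normD y z; rewrite !modulusE -rmorphD lecE /= => /andP[].
Qed.

Lemma modulusM (R : rcfType) (y z : R[i]) :
  modulus (y * z) = modulus y * modulus z.
Proof.
by have := normrM y z; rewrite !modulusE -rmorphM => /(congr1 (@complex.Re R)).
Qed.

Lemma modulus0 (R : rcfType) : modulus (0 : R[i]) = 0.
Proof. by rewrite /modulus normr0. Qed.

Lemma modulus_eq0 (R : rcfType) (z : R[i]) : modulus z = 0 -> z = 0.
Proof. by move=> z0; apply/normr0_eq0; rewrite modulusE z0. Qed.

Section ell2.
Variables (R : realType) (I : choiceType).
Local Notation C := R[i].

Definition sqnorm (x : I -> C^o) : \bar R :=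
  (\esum_(i in [set: I]) ((modulus (x i)) ^+ 2)%:E)%E.

Lemma sqnorm_ge0 x : (0 <= sqnorm x)%E.
Proof. by apply: esum_ge0 => i _; rewrite lee_fin sqr_ge0. Qed.

Lemma sqnorm_coord x i : (((modulus (x i)) ^+ 2)%:E <= sqnorm x)%E.
Proof.
apply: esum_ge; exists [set i]; first by split; [exact: finite_set1|].
by rewrite fsbig_set1.
Qed.


Let sqnormZ_le (z : C) (x : I -> C^o) :
  (sqnorm (z *: x) <= (modulus z ^+ 2)%:E * sqnorm x)%E.
Proof.
apply: ge_ereal_sup => _ [J [finJ _] <-].
rewrite (eq_fsbigr (fun i => (modulus z ^+ 2)%:E * (modulus (x i) ^+ 2)%:E)%E).
  rewrite -ge0_mule_fsumr; last by move=> i; rewrite lee_fin sqr_ge0.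
  rewrite lee_wpmul2l ?lee_fin ?sqr_ge0//.
  by apply: esum_ge; exists J.
by move=> i _; rewrite -EFinM -exprMn -modulusM.
Qed.

Lemma sqnormZ (z : C) (x : I -> C^o) :
  sqnorm (z *: x) = ((modulus z ^+ 2)%:E * sqnorm x)%E.
Proof.
have [->|z0] := eqVneq z 0.
  rewrite modulus0 expr0n mul0e; apply: esum1 => i _.
  by rewrite /GRing.scale/= scale0r modulus0 expr0n.
apply/eqP; rewrite eq_le sqnormZ_le/=.
have mz0 : modulus z != 0 by apply: contra_neq z0; exact: modulus_eq0.
have := sqnormZ_le z^-1 (z *: x); rewrite scalerA mulVf// scale1r => h.
have -> : sqnorm (z *: x) =
    ((modulus z ^+ 2)%:E * ((modulus z^-1 ^+ 2)%:E * sqnorm (z *: x)))%E.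
  rewrite muleA -EFinM -exprMn -modulusM mulfV// /modulus normr1/=.
  by rewrite expr1n mul1e.
by rewrite lee_wpmul2l ?lee_fin ?sqr_ge0.
Qed.

Lemma sqnorm0 : sqnorm 0 = 0%E.
Proof. by rewrite -(scale0r 0) sqnormZ modulus0 expr0n mul0e. Qed.

Definition square_summable : {pred I -> C^o} :=
  mem [set x | (sqnorm x < +oo)%E].

Lemma square_summableP (x : I -> C^o) :
  x \in square_summable -> sqnorm x = (fine (sqnorm x))%:E.
Proof.
by rewrite inE /= => xfin; rewrite fineK// ge0_fin_numE ?sqnorm_ge0.
Qed.

Let sqnormD_le (x y : I -> C^o) (a b : R) : 0 < a -> 0 < b ->
  (sqnorm (x + y)%R <=
   ((a + b) / a)%:E * sqnorm x + ((a + b) / b)%:E * sqnorm y)%E.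
Proof.
move=> a0 b0; apply: ge_ereal_sup => _ [J [finJ _] <-].
pose p i := modulus (x i); pose q i := modulus (y i).
apply: (@le_trans _ _
  (\sum_(i \in J) ((a + b) / a * p i ^+ 2)%:E
   + \sum_(i \in J) ((a + b) / b * q i ^+ 2)%:E)%E).
  rewrite -fsbig_split//=; apply: lee_fsum => // i _.
  rewrite -EFinD lee_fin.
  apply: (@le_trans _ _ ((p i + q i) ^+ 2)).
    by rewrite ler_pXn2r ?nnegrE ?addr_ge0 ?modulus_ge0// modulusD.
  rewrite -subr_ge0.
  have -> : (a + b) / a * p i ^+ 2 + (a + b) / b * q i ^+ 2 - (p i + q i) ^+ 2
          = (b * p i - a * q i) ^+ 2 / (a * b).
    by field; rewrite (gt_eqF a0) (gt_eqF b0).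
  by rewrite divr_ge0 ?sqr_ge0// mulr_ge0 ?ltW.
have ab0 : 0 <= a + b by rewrite addr_ge0 ?ltW.
by apply: leeD; under eq_fsbigr do rewrite EFinM;
  rewrite -ge0_mule_fsumr; try (by move=> i; rewrite lee_fin sqr_ge0);
  rewrite lee_wpmul2l ?lee_fin ?divr_ge0 ?(ltW a0) ?(ltW b0)//;
  apply: esum_ge; exists J.
Qed.

Lemma square_summable_submod : submod_closed square_summable.
Proof.
split=> [|z x y]; first by rewrite inE/= sqnorm0.
rewrite !inE/= => xfin yfin.
apply: le_lt_trans (sqnormD_le _ _ ltr01 ltr01) _.
rewrite sqnormZ; apply: lte_add_pinfty.
  by rewrite lte_mul_pinfty ?lee_fin ?divr_ge0 ?addr_ge0//
    lte_mul_pinfty ?lee_fin ?sqr_ge0.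
by rewrite lte_mul_pinfty ?lee_fin ?divr_ge0 ?addr_ge0.
Qed.

HB.instance Definition _ :=
  GRing.isSubmodClosed.Build _ _ square_summable square_summable_submod.

Record l2 := L2 { l2_val :> I -> C^o ; l2P : l2_val \in square_summable }.

HB.instance Definition _ := [isSub for l2_val].
HB.instance Definition _ := gen_eqMixin l2.
HB.instance Definition _ := gen_choiceMixin l2.
HB.instance Definition _ := [SubChoice_isSubLmodule of l2 by <:].

Definition l2norm (x : l2) : R := Num.sqrt (fine (sqnorm x)).


Lemma l2norm_sq (x : l2) : (l2norm x) ^+ 2 = fine (sqnorm x).
Proof. by rewrite sqr_sqrtr ?fine_ge0 ?sqnorm_ge0. Qed.

Lemma l2norm_eq0 (x : l2) : l2norm x = 0 -> x = 0.
Proof.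
move=> x0; have := l2norm_sq x; rewrite x0 expr0n/= => /esym sq0.
apply/val_inj/funext => i /=; apply: modulus_eq0.
have := sqnorm_coord x i; rewrite (square_summableP (l2P x)) sq0 lee_fin => h.
by apply/eqP; rewrite -sqrf_eq0 eq_le h sqr_ge0.
Qed.

Lemma l2normD (x y : l2) : l2norm (x + y) <= l2norm x + l2norm y.
Proof.
have [x0|x0] := eqVneq (l2norm x) 0.
  by rewrite (l2norm_eq0 x0) add0r lerDr sqrtr_ge0.
have [y0|y0] := eqVneq (l2norm y) 0.
  by rewrite (l2norm_eq0 y0) addr0 lerDl sqrtr_ge0.
have xp : 0 < l2norm x by rewrite lt_def x0 sqrtr_ge0.
have yp : 0 < l2norm y by rewrite lt_def y0 sqrtr_ge0.
have := sqnormD_le x y xp yp.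
have -> : (val x + val y)%R = val (x + y) by [].
rewrite (square_summableP (l2P x)) (square_summableP (l2P y)).
rewrite (square_summableP (l2P (x + y))) -!l2norm_sq -!EFinM -EFinD lee_fin.
have -> : (l2norm x + l2norm y) / l2norm x * l2norm x ^+ 2 +
          (l2norm x + l2norm y) / l2norm y * l2norm y ^+ 2
        = (l2norm x + l2norm y) ^+ 2 by field; rewrite x0 y0.
by rewrite ler_pXn2r ?nnegrE ?addr_ge0 ?sqrtr_ge0.
Qed.

Lemma l2normZ (z : C) (x : l2) : l2norm (z *: x) = modulus z * l2norm x.
Proof.
rewrite /l2norm; have -> : l2_val (z *: x) = z *: (x : I -> C^o) by [].
rewrite sqnormZ (square_summableP (l2P x)) -EFinM/=.
by rewrite sqrtrM ?sqr_ge0// sqrtr_sqr ger0_norm ?modulus_ge0.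
Qed.

Let cnorm (x : l2) : C := (l2norm x)%:C%C.

Let cnormD (x y : l2) : cnorm (x + y) <= cnorm x + cnorm y.
Proof. by rewrite /cnorm -rmorphD lecR l2normD. Qed.

Let cnormZ (z : C) (x : l2) : cnorm (z *: x) = `|z| * cnorm x.
Proof. by rewrite /cnorm l2normZ rmorphM modulusE. Qed.

Let cnorm0_eq0 (x : l2) : cnorm x = 0 -> x = 0.
Proof. by move=> /(congr1 (@complex.Re R)) /= /l2norm_eq0. Qed.

HB.instance Definition _ :=
  Lmodule_isNormed.Build C l2 cnormD cnormZ cnorm0_eq0.

(* Linear in the first variable; the sum is the limit along the net of finite
   subsets of I. *)
Definition dot (x y : l2) : C := summability.sum (fun i => x i * (y i)^* : C^o).

Definition unit_vector (j : I) : I -> C^o := fun i => (i == j)%:R.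

Lemma unit_vectorP j : unit_vector j \in square_summable.
Proof.
rewrite inE/= /sqnorm (esumID [set j]) => [|i _]; last by rewrite lee_fin sqr_ge0.
rewrite setTI esum_set1 ?lee_fin ?sqr_ge0// esum1 ?adde0 ?ltry// => i [_ /= ij].
by rewrite /unit_vector (introF eqP ij) modulus0 expr0n.
Qed.

Definition e_ (j : I) : l2 := L2 (unit_vectorP j).

Definition bounded_operator : {pred l2 -> l2} :=
  mem [set T | linear T /\ continuous T].

Lemma bounded_operator_submod : submod_closed bounded_operator.
Proof.
split=> [|z S T]; rewrite !inE/=.
  have z0 (u : l2) : (0 : l2 -> l2) u = 0 by [].
  split=> [a x y|x]; first by rewrite !z0 scaler0 addr0.
  by apply: cst_continuous.
move=> [linS ctsS] [linT ctsT]; split=> [a x y|x].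
  rewrite [LHS](_ : _ = z *: S (a *: x + y) + T (a *: x + y))//.
  rewrite [RHS](_ : _ = a *: (z *: S x + T x) + (z *: S y + T y))//.
  rewrite linS linT !scalerDr !scalerA [a * z]mulrC -!addrA; congr (_ + _).
  by rewrite addrCA.
apply: (@continuousD _ _ _ (z *: S) T x); last exact: ctsT.
apply: (@continuousZl_tmp _ _ _ S z x); exact: ctsS.
Qed.

HB.instance Definition _ :=
  GRing.isSubmodClosed.Build _ _ bounded_operator bounded_operator_submod.

Record Bop := MkBop { Bop_val :> l2 -> l2 ; BopP : Bop_val \in bounded_operator }.

HB.instance Definition _ := [isSub for Bop_val].
HB.instance Definition _ := gen_eqMixin Bop.
HB.instance Definition _ := gen_choiceMixin Bop.
HB.instance Definition _ := [SubChoice_isSubLmodule of Bop by <:].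

Definition opnorm (T : Bop) : \bar R :=
  ereal_sup [set (l2norm (T x))%:E | x in [set x | l2norm x <= 1]].

(* The (i, j) matrix coefficient <T e_j, e_i>. *)
Definition entry (T : Bop) (i j : I) : C := T (e_ j) i.

Definition positive (S : Bop) := forall x, 0 <= dot (S x) x.

Definition adjoint (T T' : Bop) := forall x y, dot (T x) y = dot x (T' y).

(* S = |T| = (T^* T)^(1/2): the unique positive square root of T^* T. *)
Definition absolute_value (T S : Bop) :=
  positive S /\ exists2 T' : Bop, adjoint T T' & forall x, S (S x) = T' (T x).

(* Tr |T| < +oo. *)
Definition trace_class (T : Bop) : Prop :=
  exists2 S : Bop, absolute_value T S &
    (\esum_(i in [set: I]) (complex.Re (entry S i i))%:E < +oo)%E.

Record S1 := MkS1 { S1_val :> Bop ; S1P : trace_class S1_val }.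

(* <T, b> = \sum_(i, j) t_ij b_ij. The family (t_ij b_ij) need not be absolutely
   summable over I * I, so the double sum is taken as \sum_i \sum_j, that is
   Tr (T b^T); each of the two successive sums converges absolutely. *)
Definition bracket (T : Bop) (b : S1) : C :=
  summability.sum (fun i =>
    summability.sum (fun j => entry T i j * entry b i j : C^o) : C^o).

End ell2.

Arguments e_ {R I} j.

(* A family of norms on M_n(V), as carried by an operator space V. *)
Definition matrix_norms (R : realType) (V : Type) := forall n, 'M[V]_n -> \bar R.

(* sup_n || id_(M_n) (x) u : M_n(V) -> M_n(W) ||; n = 0 only contributes 0 to
   the supremum. *)
Definition cbnorm (R : realType) (V W : Type) (nV : matrix_norms R V)
    (nW : matrix_norms R W) (u : V -> W) : \bar R :=
  ereal_sup [set r | exists n (v : 'M[V]_n),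
    (nV n v <= 1)%E /\ r = nW n (map_mx u v)].

(* The norm of the Hilbertian direct sum of copies of V indexed by K. *)
Definition tuple_norm (R : realType) (V : normedModType R[i]) (K : finType)
    (x : K -> V) : R :=
  Num.sqrt (\sum_k (complex.Re `|x k|) ^+ 2).

(* The operator norm of the block matrix F acting on that direct sum. *)
Definition block_norm (R : realType) (V : normedModType R[i]) (K : finType)
    (F : K -> K -> V -> V) : \bar R :=
  ereal_sup [set (tuple_norm (fun k => \sum_l F k l (x l)))%:E |
             x in [set x : K -> V | tuple_norm x <= 1]].

(* M_n(B(H)) = B(H^n). *)
Definition Bop_norms (R : realType) (I : choiceType) : matrix_norms R (Bop R I) :=
  fun n T => block_norm (fun k l => T k l : l2 R I -> l2 R I).

(* M_n(M_m) = M_(n m) = B(l^2_(n m)), with rows and columns indexed by pairs. *)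
Definition Mn_norms (R : realType) (m : nat) : matrix_norms R 'M[R[i]]_m :=
  fun n a => block_norm (fun (k l : 'I_n * 'I_m) (z : R[i]^o) =>
    a k.1 l.1 k.2 l.2 *: z).

(* The predual structure: S^1 is embedded in B(l^2_I)^* by the bracket, and
   M_n(B(l^2_I)^* ) = CB(B(l^2_I), M_n). *)
Definition S1_norms (R : realType) (I : choiceType) : matrix_norms R (S1 R I) :=
  fun n b => cbnorm (@Bop_norms R I) (@Mn_norms R n)
    (fun T => \matrix_(k < n, l < n) bracket T (b k l)).

Definition completely_bounded (R : realType) (V W : Type)
    (nV : matrix_norms R V) (nW : matrix_norms R W) (u : V -> W) : Prop :=
  (cbnorm nV nW u < +oo)%E.

(* S1 carries no lmodType structure, so linearity is stated for those linear
   combinations, computed in Bop, that are of trace class (all of them are). *)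
Definition linear_on_S1 (R : realType) (I : choiceType)
    (u : S1 R I -> Bop R I) : Prop :=
  forall (z : R[i]) (b c d : S1 R I),
    S1_val d = z *: S1_val b + S1_val c -> u d = z *: u b + u c.

(* u is the map M_A : [b_ij] |-> [a_ij b_ij]. *)
Definition schur_multiplier (R : realType) (I : choiceType) (A : Bop R I)
    (u : S1 R I -> Bop R I) : Prop :=
  forall b i j, entry (u b) i j = entry A i j * entry b i j.

(* Main.v *)
(* For finite F in I, the operator matrix [a_ij e_ij] indexed by F is the
   conjugate of the compression A_F by the isometry e_i |-> e_i (x) e_i, so it
   has norm ||A_F|| <= ||A||. Pairing it with b in the unit ball of M_n(S^1)
   yields [a_ij (b_kl)_ij], a compression of [M_A(b_kl)], which bounds the
   cb-norm from above. Conversely [e_ij] has norm at most 1 in M_F(S^1), as it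
   represents the compression T |-> T_F, and M_A maps it to [a_ij e_ij]; taking
   the supremum over F gives the lower bound. The operator M_A(b) exists because
   b is Hilbert-Schmidt and the entries of A are bounded. *)
Require Import Defs.
From HB Require Import structures.
From mathcomp Require Import all_boot all_order all_algebra.
From mathcomp Require Import complex finmap.
From mathcomp Require Import all_classical all_reals all_analysis.
From mathcomp Require Import summability.
From mathcomp Require Import ring lra.

Set Implicit Arguments.
Unset Strict Implicit.
Unset Printing Implicit Defensive.

Import Order.TTheory GRing.Theory Num.Theory.
Import numFieldNormedType.Exports.

Local Open Scope classical_set_scope.
Local Open Scope ring_scope.
#[local] Existing Instance totally_filter.

(** * Finite sums and truncations in $\ell^2_I$ *)

Section l2_theory.
Variables (R : realType) (I : choiceType).
Local Notation C := R[i].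
Local Notation l2 := (l2 R I).
Implicit Types (x y : l2) (A B : {fset I}).

Lemma l2norm_ge0 x : 0 <= l2norm x.
Proof. exact: sqrtr_ge0. Qed.

Lemma sqnorm_le (x : I -> C^o) (c : R) :
  (forall A, \sum_(i <- A) modulus (x i) ^+ 2 <= c) -> (sqnorm x <= c%:E)%E.
Proof.
move=> xc; apply: ge_ereal_sup => _ [J [finJ _] <-].
by rewrite fsbig_finite//= sumEFin lee_fin.
Qed.

Lemma sum_sqr_modulus_le x A : \sum_(i <- A) modulus (x i) ^+ 2 <= l2norm x ^+ 2.
Proof.
rewrite l2norm_sq -lee_fin -(square_summableP (l2P x)) -sumEFin.
apply: esum_ge; exists [set` A]; first by split => //; exact: finite_fset.
by rewrite -fsbig_seq// fset_uniq.
Qed.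

Lemma l2norm_sqr_le x (c : R) :
  (forall A, \sum_(i <- A) modulus (x i) ^+ 2 <= c) -> l2norm x ^+ 2 <= c.
Proof.
by move=> /sqnorm_le; rewrite l2norm_sq (square_summableP (l2P x)) lee_fin.
Qed.

Lemma square_summable_of (x : I -> C^o) (c : R) :
  (forall A, \sum_(i <- A) modulus (x i) ^+ 2 <= c) -> x \in square_summable (I:=I).
Proof. by move=> /sqnorm_le xc; rewrite inE /=; apply: le_lt_trans xc (ltry _). Qed.

Lemma modulus_coord x i : modulus (x i) <= l2norm x.
Proof.
rewrite -(@ler_pXn2r _ 2)// ?nnegrE ?modulus_ge0 ?l2norm_ge0//.
by have := sum_sqr_modulus_le x [fset i]%fset; rewrite big_seq_fset1.
Qed.

(** The partial sums increase with the finite set and their least upper bound is the squared norm,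
    so the net converges to it. *)
Lemma cvg_sum_sqr_modulus x :
  (fun A => \sum_(i <- A) modulus (x i) ^+ 2) @ totally --> l2norm x ^+ 2.
Proof.
apply/cvgrPdist_le => e e0.
have [A hA] : exists A, l2norm x ^+ 2 - e <= \sum_(i <- A) modulus (x i) ^+ 2.
  apply: contrapT => /forallNP h.
  have : l2norm x ^+ 2 <= l2norm x ^+ 2 - e.
    by apply: l2norm_sqr_le => A; have /negP := h A; rewrite -ltNge => /ltW.
  by rewrite lerBrDr gerDl leNgt e0.
exists A => // B /= AB.
rewrite ger0_norm ?subr_ge0 ?sum_sqr_modulus_le// lerBlDr addrC -lerBlDr.
apply: (le_trans hA).
rewrite [leRHS](big_fsetID _ (mem A))/=.
have -> : [fset i in B | i \in A]%fset = A.
  by apply/fsetP => i; rewrite !inE/= andb_idl//; apply: (fsubsetP AB).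
by rewrite lerDl sumr_ge0// => i _; rewrite sqr_ge0.
Qed.

Lemma l2D x y i : (x + y) i = x i + y i. Proof. by []. Qed.
Lemma l2N x i : (- x) i = - x i. Proof. by []. Qed.
Lemma l2Z (z : C) x i : (z *: x) i = z * x i. Proof. by []. Qed.
Lemma l2_sum (K : Type) (s : seq K) (F : K -> l2) i :
  (\sum_(k <- s) F k) i = \sum_(k <- s) F k i.
Proof. by elim: s => [|k s IH]; rewrite ?big_nil// !big_cons l2D IH. Qed.

Lemma e_E (j i : I) : e_ j i = (i == j)%:R :> C. Proof. by []. Qed.

(** The orthogonal projection onto the span of the [e_ i] with [i] in [A], written as a finite
    combination so that linear maps can be evaluated on it termwise. *)
Definition trunc A x : l2 := \sum_(i <- A) x i *: e_ i.

Lemma truncE A x i : trunc A x i = if i \in A then x i else 0.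
Proof.
rewrite /trunc l2_sum; case: ifPn => iA.
  rewrite (big_fsetD1 i iA) l2Z e_E eqxx mulr1 big1_seq => [|j]; first exact: addr0.
  move=> /andP[_]; rewrite !inE => /andP[/negPf ji _].
  by rewrite l2Z e_E eq_sym ji mulr0.
rewrite big1_seq => [//|j /andP[_ jA]]; rewrite l2Z e_E.
by case: eqP => [ij|_]; [rewrite ij jA in iA|rewrite mulr0].
Qed.

Lemma modulusN (z : C) : modulus (- z) = modulus z.
Proof. by rewrite /modulus normrN. Qed.

Lemma l2normN x : l2norm (- x) = l2norm x.
Proof. by rewrite -scaleN1r l2normZ modulusN /modulus normr1 mul1r. Qed.

Lemma l2norm0 : l2norm (0 : l2) = 0.
Proof. by rewrite -(scale0r 0) l2normZ modulus0 mul0r. Qed.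

(** Over a finite [B], the remainder only sees the coordinates of [x] in [B] outside [A]; adding
    those in [A] gives the sum over the union, which is at most the squared norm. *)
Lemma l2norm_sub_trunc A x :
  l2norm (x - trunc A x) ^+ 2 <= l2norm x ^+ 2 - \sum_(i <- A) modulus (x i) ^+ 2.
Proof.
have dE i : (x - trunc A x) i = if i \in A then 0 else x i.
  by rewrite l2D l2N truncE; case: ifP => _; rewrite ?subrr ?subr0.
move: (x - trunc A x) dE => d dE.
apply: l2norm_sqr_le => B; rewrite lerBrDr.
apply: le_trans (sum_sqr_modulus_le x (A `|` B)%fset).
rewrite [leRHS](big_fsetID _ (mem A))/= [leRHS]addrC.
have -> : [fset i in (A `|` B) | i \in A]%fset = A.
  by apply/fsetP => i; rewrite !inE/=; case: (i \in A); rewrite ?andbF.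
rewrite lerD2r (big_fsetID _ (mem A))/= big1_seq ?add0r => [|i /andP[_]]; last first.
  rewrite !inE/= => /andP[_ iA].
  by rewrite dE iA modulus0 expr0n.
have -> : [fset i in (A `|` B) | i \notin A]%fset = [fset i in B | i \notin A]%fset.
  by apply/fsetP => i; rewrite !inE/=; case: (i \in A); rewrite ?andbF.
rewrite le_eqVlt; apply/orP; left; apply/eqP; apply: eq_big_seq => i.
by rewrite !inE/= => /andP[_ /negPf iA]; rewrite dE iA.
Qed.

Lemma l2norm_trunc A x : l2norm (trunc A x) ^+ 2 = \sum_(i <- A) modulus (x i) ^+ 2.
Proof.
apply/eqP; rewrite eq_le; apply/andP; split.
  apply: l2norm_sqr_le => B; rewrite (big_fsetID _ (mem A))/=.
  rewrite [leLHS]addrC big1_seq ?add0r => [|i /andP[_]]; last first.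
    by rewrite !inE/= => /andP[_ /negPf iA]; rewrite truncE iA modulus0 expr0n.
  rewrite [leRHS](big_fsetID _ (mem B))/= -[leLHS]addr0 lerD//; last first.
    by rewrite sumr_ge0// => i _; rewrite sqr_ge0.
  have -> : [fset i in B | i \in A]%fset = [fset i in A | i \in B]%fset.
    by apply/fsetP => i; rewrite !inE/= andbC.
  rewrite le_eqVlt; apply/orP; left; apply/eqP; apply: eq_big_seq => i.
  by rewrite !inE/= => /andP[iA _]; rewrite truncE iA.
apply: le_trans (sum_sqr_modulus_le _ A).
rewrite le_eqVlt; apply/orP; left; apply/eqP; apply: eq_big_seq => i iA.
by rewrite truncE iA.
Qed.

Lemma cvg_trunc x : (fun A => l2norm (x - trunc A x)) @ totally --> (0 : R).
Proof.
apply/cvgrPdist_le => e e0.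
have := @cvg_sum_sqr_modulus x => /cvgrPdist_le /(_ (e ^+ 2)).
rewrite exprn_gt0// => /(_ isT); apply: filter_app; near=> A => h.
rewrite sub0r normrN ger0_norm ?l2norm_ge0//.
rewrite -(@ler_pXn2r _ 2)// ?nnegrE ?l2norm_ge0 ?(ltW e0)//.
exact: le_trans (l2norm_sub_trunc A x) (le_trans (ler_norm _) h).
Unshelve. all: by end_near. Qed.

End l2_theory.

(** * Bounded operators and their matrix entries *)

Section bounded_operators.
Variables (R : realType) (I : choiceType).
Local Notation C := R[i].
Local Notation l2 := (l2 R I).
Local Notation Bop := (Bop R I).
Implicit Types (x y : l2) (A B : {fset I}) (S T : Bop).

Lemma Bop_linear T : linear T.
Proof. by have := BopP T; rewrite inE => -[]. Qed.

HB.instance Definition _ T := GRing.isLinear.Build C l2 l2 _ (Bop_val T) (Bop_linear T).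

Lemma Bop_bounded T : exists2 K : R, 0 <= K & forall x, l2norm (T x) <= K * l2norm x.
Proof.
have ctsT : continuous T by have := BopP T; rewrite inE => -[].
have /linear_boundedP/pinfty_ex_gt0[r r0 Tr] : bounded_near T (nbhs (0 : l2)).
  exact/linear_bounded_continuous.
exists (complex.Re r) => [|x]; first by move: r0; rewrite ltcE /= => /andP[_ /ltW].
(* The bound comes as an element of [R[i]]; being positive, it is real. *)
have := Tr x; have -> : r = (complex.Re r)%:C%C.
  by move: r0; rewrite ltcE /= => /andP[/eqP i0 _]; case: r i0 Tr => ? ? /= ->.
by rewrite /Num.norm /= -rmorphM /= lecR.
Qed.

Lemma opnorm_le T (c : R) : 0 <= c -> (forall x, l2norm (T x) <= c * l2norm x) ->
  (opnorm T <= c%:E)%E.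
Proof.
move=> c0 Tc; apply: ge_ereal_sup => _ [x /= x1 <-]; rewrite lee_fin.
by apply: (le_trans (Tc x)); rewrite ler_piMr.
Qed.

Lemma opnorm_fin T : opnorm T = (fine (opnorm T))%:E.
Proof.
have [K K0 TK] := Bop_bounded T.
rewrite fineK// ge0_fin_numE; first exact: le_lt_trans (opnorm_le K0 TK) (ltry _).
apply: ereal_sup_ubound; exists 0; last by rewrite linear0 l2norm0.
by rewrite /= l2norm0.
Qed.

Lemma opnorm_ge0 T : 0 <= fine (opnorm T).
Proof.
rewrite -lee_fin -opnorm_fin; apply: ereal_sup_ubound; exists 0.
  by rewrite /= l2norm0.
by rewrite linear0 l2norm0.
Qed.

Lemma l2norm_Bop T x : l2norm (T x) <= fine (opnorm T) * l2norm x.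
Proof.
have [x0|x0] := eqVneq (l2norm x) 0.
  by rewrite (l2norm_eq0 x0) linear0 l2norm0 mulr0.
have xp : 0 < l2norm x by rewrite lt_def x0 l2norm_ge0.
have mx : modulus ((l2norm x)^-1)%:C%C = (l2norm x)^-1.
  by rewrite /modulus normc_def /= expr0n addr0 sqrtr_sqr ger0_norm// invr_ge0 ltW.
rewrite -ler_pdivrMr// mulrC -{1}mx -l2normZ -linearZ /=.
rewrite -lee_fin -opnorm_fin; apply: ereal_sup_ubound.
by exists ((l2norm x)^-1%:C%C *: x) => //=; rewrite l2normZ mx mulVf.
Qed.

(** The converse of [Bop_bounded], through which concrete operators are constructed. *)
Lemma bounded_operatorP (f : l2 -> l2) (K : R) :
  linear f -> 0 <= K -> (forall x, l2norm (f x) <= K * l2norm x) ->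
  f \in bounded_operator (R := R) (I := I).
Proof.
move=> linf K0 fK; rewrite inE; split => //.
pose F : {linear l2 -> l2} := HB.pack f (GRing.isLinear.Build C l2 l2 _ f linf).
have /linear_bounded_continuous : bounded_near F (nbhs (0 : l2)) => //.
apply/linear_boundedP; exists K%:C%C; split; first by rewrite /= ger0_real// lecR.
move=> r /ltW Kr x; apply: le_trans (ler_wpM2r (normr_ge0 x) Kr).
by rewrite /Num.norm /= -rmorphM /= lecR.
Qed.

Lemma Bop_trunc T A x i : T (trunc A x) i = \sum_(j <- A) entry T i j * x j.
Proof.
rewrite /trunc linear_sum l2_sum; apply: eq_bigr => j _.
by rewrite linearZ_LR l2Z mulrC.
Qed.

Lemma cvg_Bop_trunc T x :
  (fun A => l2norm (T x - T (trunc A x))) @ totally --> (0 : R).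
Proof.
apply: (squeeze_cvgr (f := fun=> 0)
  (h := fun A => fine (opnorm T) * l2norm (x - trunc A x))).
- near=> A; rewrite l2norm_ge0 /= -linearB; exact: l2norm_Bop.
- exact: cvg_cst.
- rewrite -[X in _ --> X](mulr0 (fine (opnorm T))).
  by apply: cvgM; [exact: cvg_cst | exact: cvg_trunc].
Unshelve. all: by end_near. Qed.

(** Operators with the same entries agree on truncations. At [x] their difference is therefore
    bounded by two truncation errors, both of which tend to 0. *)
Lemma Bop_ext S T : (forall i j, entry S i j = entry T i j) -> S = T.
Proof.
move=> ST; apply/val_inj/funext => x /=; apply/eqP; rewrite -subr_eq0; apply/eqP.
apply: l2norm_eq0; apply/eqP; rewrite eq_le l2norm_ge0 andbT.
have cST : (fun A => l2norm (S x - S (trunc A x)) + l2norm (T x - T (trunc A x)))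
    @ totally --> (0 + 0 : R).
  by apply: cvgD; exact: cvg_Bop_trunc.
rewrite -[leRHS]addr0; apply: (cvgr_to_ge cST); near=> A.
have -> : S x - T x = (S x - S (trunc A x)) - (T x - T (trunc A x)).
  have -> : S (trunc A x) = T (trunc A x).
    apply/val_inj/funext => i; rewrite [LHS]Bop_trunc [RHS]Bop_trunc.
    by apply: eq_bigr => j _; rewrite ST.
  by rewrite opprB addrA subrK.
by apply: le_trans (l2normD _ _) _; rewrite l2normN.
Unshelve. all: by end_near. Qed.

End bounded_operators.

(** * Limits and unordered sums of complex numbers *)

Section complex_limits.
Variable R : realType.
Local Notation C := R[i].

Lemma modulus_re (r : R) : modulus r%:C%C = `|r|.
Proof. by rewrite /modulus normc_def /= expr0n addr0 sqrtr_sqr. Qed.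

Lemma modulus_conj (z : C) : modulus (z^*) = modulus z.
Proof. by rewrite /modulus norm_conjC. Qed.

Lemma mul_conj_modulus (z : C) : z * z^* = ((modulus z) ^+ 2)%:C%C.
Proof. by rewrite -normCK modulusE rmorphXn. Qed.

Lemma cvg_sum_seq (T : Type) (F : set_system T) (FF : Filter F) (K : Type)
    (V : normedModType R) (s : seq K) (f : K -> T -> V) (l : K -> V) :
  (forall k, f k @ F --> l k) ->
  (fun t => \sum_(k <- s) f k t) @ F --> \sum_(k <- s) l k.
Proof.
move=> fl; elim: s => [|k s IH].
  rewrite big_nil; under eq_fun do rewrite big_nil; exact: cvg_cst.
rewrite big_cons; under eq_fun do rewrite big_cons; exact: cvgD.
Qed.

Lemma cvg_real_complex (T : Type) (F : set_system T) (FF : Filter F)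
    (f : T -> R) (l : R) :
  f @ F --> l -> (fun t => (f t)%:C%C : C^o) @ F --> (l%:C%C : C^o).
Proof.
move=> fl; apply/cvgrPdist_le => e e0.
(* Radii in [C^o] are complex numbers; a positive one has zero imaginary part. *)
have eE : e = (complex.Re e)%:C%C.
  by move: e0; rewrite ltcE /= => /andP[/eqP i0 _]; case: e i0 => ? ? /= ->.
have e0' : 0 < complex.Re e by move: e0; rewrite ltcE /= => /andP[].
move/cvgrPdist_le : fl => /(_ _ e0'); apply: filterS => t.
by rewrite -rmorphB modulusE modulus_re eE lecR.
Qed.

Lemma cvg_mulc (T : Type) (F : set_system T) (FF : Filter F)
    (c : C) (f : T -> C^o) (l : C^o) :
  f @ F --> l -> (fun t => c * f t : C^o) @ F --> (c * l : C^o).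
Proof.
move=> fl; have h : (fun=> c : C^o) @ F --> (c : C^o) by exact: cvg_cst.
exact: (@cvgM C T F FF _ f c l h fl).
Qed.

Lemma cvg_addc (T : Type) (F : set_system T) (FF : Filter F)
    (f g : T -> C^o) (l m : C^o) :
  f @ F --> l -> g @ F --> m -> (fun t => f t + g t : C^o) @ F --> (l + m : C^o).
Proof. by move=> fl gm; exact: (@cvgD C C^o T F FF f g l m fl gm). Qed.

Lemma cvg_conj (T : Type) (F : set_system T) (FF : Filter F)
    (f : T -> C^o) (l : C^o) :
  f @ F --> l -> (fun t => (f t)^* : C^o) @ F --> (l^* : C^o).
Proof.
move=> /cvgrPdist_le fl; apply/cvgrPdist_le => e /fl; apply: filterS => t.
by rewrite -rmorphB norm_conjC.
Qed.

Lemma partial_sumE (I : choiceType) (V : zmodType) (f : I -> V) (A : {fset I}) :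
  partial_sum f A = \sum_(i <- A) f i.
Proof. by rewrite /partial_sum big_seq_fsetE. Qed.

(** The partial sums are constant as soon as the finite set contains [i]. *)
Lemma sum_support1 (I : choiceType) (f : I -> C^o) (i : I) :
  (forall j, j != i -> f j = 0) -> summability.sum f = f i.
Proof.
move=> fi; apply: cvg_lim => //; apply: cvg_near_cst.
exists [fset i]%fset => //= A iA; rewrite partial_sumE.
rewrite (big_fsetD1 i); last by rewrite (fsubsetP iA)// inE.
rewrite big1_seq => [|j /andP[_]]; first exact: addr0.
by rewrite !inE => /andP[/fi].
Qed.

End complex_limits.

(** * The inner product as a convergent sum *)

Section inner_product.
Variables (R : realType) (I : choiceType).
Local Notation C := R[i].
Local Notation l2 := (l2 R I).
Local Notation Bop := (Bop R I).
Implicit Types (x y z : l2) (A B : {fset I}) (S T : Bop).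

Let polarization (u v : C) : u * v^* =
  4^-1 * ((modulus (u + v)) ^+ 2)%:C%C + - 4^-1 * ((modulus (u - v)) ^+ 2)%:C%C
  + 4^-1 * 'i * ((modulus (u + 'i * v)) ^+ 2)%:C%C
  + - (4^-1 * 'i) * ((modulus (u - 'i * v)) ^+ 2)%:C%C.
Proof.
rewrite -(mul_conj_modulus (u + v)) -(mul_conj_modulus (u - v)).
rewrite -(mul_conj_modulus (u + 'i * v)) -(mul_conj_modulus (u - 'i * v)).
have -> : (u + 'i * v)^* = u^* - 'i * v^* by rewrite rmorphD rmorphM /= conjCi mulNr.
have -> : (u - 'i * v)^* = u^* + 'i * v^* by rewrite rmorphB rmorphM /= conjCi mulNr opprK.
rewrite rmorphD rmorphB /=.
have i2 : 'i * 'i = -1 :> C by rewrite -expr2 sqrCi.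
have n4 : 4^-1 * 4 = 1 :> C by rewrite mulVf// pnatr_eq0.
by ring: i2 n4.
Qed.

Lemma cvg_dot x y :
  (fun A => \sum_(i <- A) x i * (y i)^* : C^o) @ totally --> (dot x y : C^o).
Proof.
(* [dot] is defined as a limit, which is meaningful only once convergence is known. Polarization
   supplies it: the partial sums combine those of four squared norms. *)
suff h : cvg ((fun A => \sum_(i <- A) x i * (y i)^* : C^o) @ totally).
  rewrite /dot /summability.sum; have -> : partial_sum (fun i => x i * (y i)^* : C^o) =
    (fun A => \sum_(i <- A) x i * (y i)^* : C^o) by apply/funext => A; rewrite partial_sumE.
  exact: h.
pose N z A : C^o := (\sum_(i <- A) (modulus (z i)) ^+ 2)%:C%C.
have -> : (fun A => \sum_(i <- A) x i * (y i)^* : C^o) = (fun A =>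
    4^-1 * N (x + y) A + - 4^-1 * N (x - y) A + 4^-1 * 'i * N (x + 'i *: y) A
    + - (4^-1 * 'i) * N (x - 'i *: y) A).
  apply/funext => A; rewrite /N !rmorph_sum /= !mulr_sumr -!big_split /=.
  by apply: eq_bigr => i _; rewrite polarization.
have cN c z : (fun A => c * N z A : C^o) @ totally -->
    (c * ((l2norm z) ^+ 2)%:C%C : C^o).
  by apply: cvg_mulc; apply: cvg_real_complex; exact: cvg_sum_sqr_modulus.
apply: cvgP; apply: cvg_addc (cN _ _); apply: cvg_addc (cN _ _).
exact: cvg_addc (cN _ _) (cN _ _).
Qed.

(** By uniqueness of limits, an identity between finite sums passes to [dot]; the algebraic rules
    below are obtained in this way. *)
Lemma dot_lim x y (f : {fset I} -> C^o) (l : C^o) : f @ totally --> l ->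
  (forall A, f A = \sum_(i <- A) x i * (y i)^*) -> dot x y = l.
Proof.
move=> + /funext fE; rewrite fE => fl.
by apply: cvg_unique (@cvg_dot x y) fl.
Qed.

Lemma dotxx x : dot x x = ((l2norm x) ^+ 2)%:C%C.
Proof.
apply: dot_lim; first by apply: cvg_real_complex; exact: (@cvg_sum_sqr_modulus _ _ x).
by move=> A /=; rewrite rmorph_sum /=; apply: eq_bigr => i _; rewrite mul_conj_modulus.
Qed.

Lemma dot_linear (a : C) x y z : dot (a *: x + y) z = a * dot x z + dot y z.
Proof.
apply: dot_lim.
  by apply: cvg_addc; [apply: cvg_mulc|]; exact: cvg_dot.
move=> A /=; rewrite mulr_sumr -big_split /=.
by apply: eq_bigr => i _; rewrite mulrDl mulrA.
Qed.

Lemma dotC x y : dot y x = (dot x y)^*.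
Proof.
apply: dot_lim; first by apply: cvg_conj; exact: cvg_dot.
move=> A /=; rewrite rmorph_sum /=; apply: eq_bigr => i _.
by rewrite rmorphM /= conjCK mulrC.
Qed.

Lemma dot_linearr (a : C) x y z : dot z (a *: x + y) = a^* * dot z x + dot z y.
Proof. by rewrite dotC dot_linear rmorphD rmorphM /= -!dotC. Qed.

Lemma dot_er x j : dot x (e_ j) = x j.
Proof.
rewrite /dot (@sum_support1 _ _ _ j) => [|i ij]; rewrite e_E ?eqxx ?(negPf ij).
  by rewrite conjC1 mulr1.
by rewrite conjC0 mulr0.
Qed.

End inner_product.

(* The hypotheses say that a sesquilinear form takes real values at x + i y
   and at x + y. *)
Lemma real_form_conj (K : numFieldType) (a b u v u' v' i : K) : i * i = -1 ->
  a + i * u' + (- i * v' + - i * i * b) = a + - i * u + (i * v + i * - i * b) ->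
  a + 1 * u' + (1 * v' + 1 * 1 * b) = a + 1 * u + (1 * v + 1 * 1 * b) -> v = u'.
Proof.
move=> i2 e1 e2.
have /mulfI : 2 != 0 :> K by rewrite pnatr_eq0.
apply; apply/eqP; rewrite -subr_eq0; apply/eqP.
set l1 := LHS in e1; set r1 := RHS in e1; set l2 := LHS in e2; set r2 := RHS in e2.
have -> : 2 * v - 2 * u' = i * (l1 - r1) - (l2 - r2) by rewrite /l1 /r1 /l2 /r2; ring: i2.
by rewrite e1 e2 !subrr mulr0 subrr.
Qed.

(** * Positive operators, trace class and Hilbert-Schmidt operators *)

Section positive_operators.
Variables (R : realType) (I : choiceType).
Local Notation C := R[i].
Local Notation l2 := (l2 R I).
Local Notation Bop := (Bop R I).
Implicit Types (x y z : l2) (A B : {fset I}) (S T : Bop).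

Lemma ge0_conj (a : C) : 0 <= a -> a^* = a.
Proof. by move=> a0; apply/CrealP; exact: ger0_real. Qed.

Lemma ge0_complexE (a : C) : 0 <= a -> a = (complex.Re a)%:C%C.
Proof. by case: a => ar ai; rewrite lecE /= => /andP[/eqP -> _]. Qed.

Lemma ge0_Re (a : C) : 0 <= a -> 0 <= complex.Re a.
Proof. by rewrite lecE => /andP[]. Qed.

Lemma dotDl x y z : dot (x + y) z = dot x z + dot y z.
Proof. by rewrite -{1}[x]scale1r dot_linear mul1r. Qed.

Lemma dotDr x y z : dot z (x + y) = dot z x + dot z y.
Proof. by rewrite -{1}[x]scale1r dot_linearr conjC1 mul1r. Qed.

Lemma dotZl (a : C) x z : dot (a *: x) z = a * dot x z.
Proof.
have d0 : dot 0 z = 0.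
  by apply: (@addrI _ (dot 0 z)); rewrite -dotDl !addr0.
by rewrite -[a *: x]addr0 dot_linear d0 addr0.
Qed.

Lemma dotZr (a : C) x z : dot z (a *: x) = a^* * dot z x.
Proof. by rewrite dotC dotZl rmorphM /= -dotC. Qed.

Let dot_comb S (a : C) x y :
  dot (S (x + a *: y)) (x + a *: y) =
  dot (S x) x + a^* * dot (S x) y + (a * dot (S y) x + a * a^* * dot (S y) y).
Proof.
by rewrite linearD linearZ_LR dotDl !dotDr !dotZl !dotZr mulrA.
Qed.

(** The form takes real values at [x + y] and at [x + i y]; comparing each value with its conjugate
    determines the cross terms. *)
Lemma positive_hermitian S x y : positive S -> dot (S y) x = (dot (S x) y)^*.
Proof.
move=> Spos; have r0 := ge0_conj (Spos x); have r1 := ge0_conj (Spos y).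
have := ge0_conj (Spos (x + 1 *: y)); have := ge0_conj (Spos (x + 'i *: y)).
rewrite !dot_comb !rmorphD !rmorphM /= r0 r1 !conjCK conjCi conjC1.
by move=> e1 e2; apply: real_form_conj e1 e2; rewrite -expr2 sqrCi.
Qed.

Lemma positive_cauchy_schwarz S x y : positive S ->
  modulus (dot (S x) y) ^+ 2 <= complex.Re (dot (S x) x) * complex.Re (dot (S y) y).
Proof.
move=> Spos; set u := dot (S x) y; set m := modulus u ^+ 2.
set a := complex.Re (dot (S x) x); set b := complex.Re (dot (S y) y).
have aE : dot (S x) x = a%:C%C by exact/ge0_complexE/Spos.
have bE : dot (S y) y = b%:C%C by exact/ge0_complexE/Spos.
have uu : u * u^* = m%:C%C by exact: mul_conj_modulus.
have m0 : 0 <= m by exact: sqr_ge0.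
have b0 : 0 <= b by exact/ge0_Re/Spos.
have a0 : 0 <= a by exact/ge0_Re/Spos.
clearbody m.
(* Positivity at the vector $x - s u y$ with $s$ real; the factor $u$ turns both cross terms into
   $-sm$. *)
have key (s : R) : 0 <= a - 2 * s * m + s ^+ 2 * m * b.
  have := Spos (x + (- s%:C%C * u) *: y); rewrite dot_comb aE bE.
  rewrite (positive_hermitian x y Spos) -/u rmorphM rmorphN /=.
  have -> : (s%:C%C)^* = s%:C%C :> C by rewrite -[LHS]/((s%:C)^*)%C conjc_real.
  have -> : a%:C%C + - s%:C%C * u^* * u + (- s%:C%C * u * u^* +
      - s%:C%C * u * (- s%:C%C * u^*) * b%:C%C) =
      (a - 2 * s * m + s ^+ 2 * m * b)%:C%C :> C.
    rewrite !(rmorphD, rmorphN, rmorphM, rmorphXn) /= -uu.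
    rewrite rmorph1; ring.
  by rewrite lecR.
have [b_eq0|b_neq0] := eqVneq b 0.
  (* When $b = 0$ the expression is affine in $s$, and if $m > 0$ then $s = (a+1)/m$ makes it equal
     to $-a-2 < 0$. *)
  rewrite b_eq0 mulr0 leNgt; apply/negP => mp.
  have := key ((a + 1) / m); rewrite b_eq0 mulr0 addr0.
  have -> : a - 2 * ((a + 1) / m) * m = - a - 2.
    by field; rewrite gt_eqF.
  by lra.
have bp : 0 < b by rewrite lt_def b_neq0.
(* The quadratic has its minimum at $s = 1/b$ (when $m > 0$). *)
have := key b^-1; have -> : a - 2 * b^-1 * m + b^-1 ^+ 2 * m * b = (a * b - m) / b.
  by field.
by rewrite pmulr_lge0 ?invr_gt0// subr_ge0.
Qed.

(** With $S = |T|$ one has $\|Te_j\| = \|Se_j\|$, and Cauchy-Schwarz for the form of $S$ gives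
    $|s_{ij}|^2 \le s_{ii}s_{jj}$. Summing over $i$ and $j$ yields the bound
    $(\mathrm{Tr}\,S)^2$. *)
Lemma trace_class_hilbert_schmidt T : trace_class T ->
  exists K : R, forall A, \sum_(j <- A) l2norm (T (e_ j)) ^+ 2 <= K.
Proof.
move=> [S [Spos [T' adjT ST]] trS].
pose tr j := complex.Re (entry S j j).
have trE j : dot (S (e_ j)) (e_ j) = entry S j j by rewrite dot_er.
have tr0 j : 0 <= tr j by rewrite /tr -trE; exact/ge0_Re/Spos.
have [K trK] : exists K, forall A, \sum_(j <- A) tr j <= K.
  exists (fine (\esum_(i in [set: I]) (tr i)%:E)%E) => A.
  rewrite -lee_fin fineK; last first.
    by rewrite ge0_fin_numE// esum_ge0// => i _; rewrite lee_fin.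
  rewrite -sumEFin; apply: esum_ge; exists [set` A]; first by split => //; exact: finite_fset.
  by rewrite -fsbig_seq// fset_uniq.
have K0 : 0 <= K by have := trK fset0; rewrite big_seq_fset0.
have TS j : l2norm (T (e_ j)) = l2norm (S (e_ j)).
  apply/eqP; rewrite -(@eqrXn2 _ 2)// ?l2norm_ge0//; apply/eqP.
  suff: dot (T (e_ j)) (T (e_ j)) = dot (S (e_ j)) (S (e_ j)).
    by rewrite !dotxx => /(congr1 (@complex.Re R)).
  by rewrite adjT -ST dotC (positive_hermitian _ _ Spos) conjCK.
have Sj j : l2norm (S (e_ j)) ^+ 2 <= tr j * K.
  apply: l2norm_sqr_le => A; apply: le_trans (ler_wpM2l (tr0 j) (trK A)).
  rewrite mulr_sumr; apply: ler_sum => i _.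
  by have := positive_cauchy_schwarz (e_ j) (e_ i) Spos; rewrite !trE dot_er.
exists (K * K) => A; apply: (@le_trans _ _ (\sum_(j <- A) tr j * K)).
  by apply: ler_sum => j _; rewrite TS.
by rewrite -mulr_suml ler_wpM2r.
Qed.

Lemma id_bounded : idfun \in bounded_operator (R := R) (I := I).
Proof. by apply: (@bounded_operatorP _ _ _ 1) => // x; rewrite mul1r. Qed.

Lemma dot_cauchy_schwarz x y : modulus (dot x y) <= l2norm x * l2norm y.
Proof.
rewrite -(@ler_pXn2r _ 2)// ?nnegrE ?modulus_ge0 ?mulr_ge0 ?l2norm_ge0//.
(* The inner product is the form of the identity operator. *)
have idpos : positive (MkBop id_bounded) by move=> z /=; rewrite dotxx lecR sqr_ge0.
by have := positive_cauchy_schwarz x y idpos; rewrite /= !dotxx /= exprMn.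
Qed.

(** The operator sends $x$ to the family of inner products of $x$ with the conjugated rows of $h$;
    Cauchy-Schwarz row by row bounds its norm by $\sqrt K$. *)
Lemma hilbert_schmidt_operator (h : I -> I -> C) (K : R) :
  (forall A B, \sum_(j <- A) \sum_(i <- B) modulus (h i j) ^+ 2 <= K) ->
  exists T, forall i j, entry T i j = h i j.
Proof.
move=> hK.
have K0 : 0 <= K by have := hK fset0 fset0; rewrite big_seq_fset0.
have rP i : (fun j => (h i j)^*) \in square_summable (R := R) (I := I).
  apply: (@square_summable_of _ _ _ K) => A; apply: le_trans (hK A [fset i]%fset).
  by apply: ler_sum => j _; rewrite big_seq_fset1 modulus_conj.
pose r i : l2 := L2 (rP i).
have rK B : \sum_(i <- B) l2norm (r i) ^+ 2 <= K.
  (* With the finite set [B] of rows fixed, the row norms are limits over finite sets [A] of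
     columns, where [hK] applies. *)
  apply: (cvgr_to_le (cvg_sum_seq _ (fun i => @cvg_sum_sqr_modulus _ _ (r i)))).
  near=> A; rewrite exchange_big /=; apply: le_trans (hK A B).
  by apply: ler_sum => j _; apply: ler_sum => i _; rewrite modulus_conj.
have fK x B : \sum_(i <- B) modulus (dot x (r i)) ^+ 2 <= K * l2norm x ^+ 2.
  rewrite mulrC; apply: le_trans (ler_wpM2l (sqr_ge0 _) (rK B)).
  rewrite mulr_sumr; apply: ler_sum => i _; rewrite -exprMn.
  by rewrite ler_pXn2r ?nnegrE ?modulus_ge0 ?mulr_ge0 ?l2norm_ge0 ?dot_cauchy_schwarz.
pose f x : l2 := L2 (square_summable_of (fK x)).
have fP : f \in bounded_operator (R := R) (I := I).
  apply: (@bounded_operatorP _ _ _ (Num.sqrt K)); last 2 first.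
  - exact: sqrtr_ge0.
  - move=> x; rewrite -(@ler_pXn2r _ 2)// ?nnegrE ?mulr_ge0 ?sqrtr_ge0 ?l2norm_ge0//.
    by rewrite exprMn (sqr_sqrtr K0); exact: (@l2norm_sqr_le _ _ (f x) _ (fK x)).
  - by move=> a x y; apply/val_inj/funext => i; exact: dot_linear.
exists (MkBop fP) => i j; rewrite /entry /=.
by rewrite dotC dot_er /= conjCK.
Unshelve. all: by end_near. Qed.

End positive_operators.

(** * Norms of block matrices *)

Section block_norms.
Variables (R : realType) (V : normedModType R[i]) (K : finType).
Implicit Types (F : K -> K -> V -> V) (x : K -> V).
Let norm (v : V) : R := complex.Re `|v|.

Let normZ (r : R) v : 0 <= r -> norm (r%:C%C *: v) = r * norm v.
Proof.
move=> r0; have vE := ge0_complexE (normr_ge0 v).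
by rewrite /norm normrZ vE modulusE modulus_re ger0_norm// -rmorphM.
Qed.

Lemma tuple_norm_ge0 x : 0 <= tuple_norm x.
Proof. exact: sqrtr_ge0. Qed.

Lemma tuple_norm_sqr x : tuple_norm x ^+ 2 = \sum_k (complex.Re `|x k|) ^+ 2.
Proof. by rewrite sqr_sqrtr// sumr_ge0// => k _; exact: sqr_ge0. Qed.

Let tuple_normZ (r : R) x : 0 <= r ->
  tuple_norm (fun k => r%:C%C *: x k) = r * tuple_norm x.
Proof.
move=> r0; apply/eqP; rewrite -(@eqrXn2 _ 2)// ?mulr_ge0 ?tuple_norm_ge0//.
rewrite exprMn !tuple_norm_sqr mulr_sumr; apply/eqP/eq_bigr => k _.
by rewrite -[complex.Re `|_ *: _|]/(norm _) normZ// exprMn.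
Qed.

Lemma block_norm_ge0 F : (0 <= block_norm F)%E.
Proof.
apply: (@le_trans _ _ (tuple_norm (fun k => \sum_l F k l 0))%:E).
  by rewrite lee_fin tuple_norm_ge0.
apply: ereal_sup_ubound; exists (fun=> 0) => //=.
by rewrite /tuple_norm big1 ?sqrtr0// => k _; rewrite normr0 expr0n.
Qed.

(** The supremum over the unit ball is replaced by a homogeneous inequality between sums of squares,
    by rescaling a nonzero tuple. All later norm estimates are stated in this form. *)
Lemma block_norm_leP F (c : R) : 0 <= c -> (forall k l, linear (F k l)) ->
  (block_norm F <= c%:E)%E <->
  (forall x, \sum_k (complex.Re `|\sum_l F k l (x l)|) ^+ 2 <=
             c ^+ 2 * \sum_k (complex.Re `|x k|) ^+ 2).
Proof.
move=> c0 linF; have F0 k l : F k l 0 = 0.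
  by have := linF k l (-1) 0 0; rewrite scaler0 add0r scaleN1r addNr.
have FZ k l a v : F k l (a *: v) = a *: F k l v.
  by have := linF k l a v 0; rewrite !addr0 F0 addr0.
split=> [Fc x|Fc]; last first.
  apply: ge_ereal_sup => _ [x /= x1 <-]; rewrite lee_fin.
  rewrite -(@ler_pXn2r _ 2)// ?nnegrE ?tuple_norm_ge0//.
  rewrite tuple_norm_sqr; apply: le_trans (Fc x) _; rewrite -tuple_norm_sqr.
  by rewrite ler_piMr ?sqr_ge0// expr_le1// tuple_norm_ge0.
pose Fx x k := \sum_l F k l (x l).
rewrite -!tuple_norm_sqr -[in leLHS]/(Fx x) -exprMn.
rewrite ler_pXn2r ?nnegrE ?mulr_ge0 ?tuple_norm_ge0//.
have [x0|x0] := eqVneq (tuple_norm x) 0.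
  have xk k : x k = 0.
    have := tuple_norm_sqr x; rewrite x0 expr0n /= => /esym/eqP.
    rewrite psumr_eq0 => [/allP /(_ k)|i _]; last exact: sqr_ge0.
    rewrite mem_index_enum sqrf_eq0 => /(_ isT)/eqP nk.
    by apply/normr0_eq0; rewrite (ge0_complexE (normr_ge0 _)) nk.
  rewrite x0 mulr0 /tuple_norm big1 ?sqrtr0// => k _.
  rewrite /Fx big1 ?normr0 ?expr0n// => l _.
  by rewrite xk F0.
have xp : 0 < tuple_norm x by rewrite lt_def x0 tuple_norm_ge0.
have ip : 0 <= (tuple_norm x)^-1 by rewrite invr_ge0 ltW.
rewrite -ler_pdivrMr// mulrC -tuple_normZ//.
rewrite -lee_fin; apply: le_trans Fc; apply: ereal_sup_ubound.
exists (fun k => ((tuple_norm x)^-1)%:C%C *: x k).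
  by rewrite /= tuple_normZ// mulVf.
congr (tuple_norm _)%:E; apply/funext => k; rewrite /Fx scaler_sumr.
by apply: eq_bigr => l _; rewrite FZ.
Qed.

End block_norms.

(** * Schur multipliers, matrix units and finite compressions *)

Section schur.
Variables (R : realType) (I : choiceType).
Local Notation C := R[i].
Local Notation l2 := (l2 R I).
Local Notation Bop := (Bop R I).
Local Notation S1 := (S1 R I).
Implicit Types (x y z : l2) (F : {fset I}) (S T : Bop).

Lemma Bop_norms_leP n (T : 'M[Bop]_n) (c : R) : 0 <= c ->
  (Bop_norms T <= c%:E)%E <->
  (forall x : 'I_n -> l2, \sum_k l2norm (\sum_l T k l (x l)) ^+ 2 <=
                          c ^+ 2 * \sum_k l2norm (x k) ^+ 2).
Proof. by move=> c0; apply: block_norm_leP => // k l; exact: Bop_linear. Qed.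

Lemma Mn_norms_leP m n (a : 'M['M[C]_m]_n) (c : R) : 0 <= c ->
  (Mn_norms a <= c%:E)%E <->
  (forall x : 'I_n -> 'I_m -> C,
    \sum_k \sum_i modulus (\sum_l \sum_j a k l i j * x l j) ^+ 2 <=
    c ^+ 2 * \sum_k \sum_i modulus (x k i) ^+ 2).
Proof.
move=> c0; have linF (k l : 'I_n * 'I_m) :
    linear ((fun z : C^o => a k.1 l.1 k.2 l.2 *: z) : C^o -> C^o).
  by move=> z u v; rewrite scalerDr !scalerA mulrC.
apply: (iff_trans (block_norm_leP c0 linF)).
have E (x : 'I_n -> 'I_m -> C) :
    \sum_k \sum_i modulus (\sum_l \sum_j a k l i j * x l j) ^+ 2 =
    \sum_(k : 'I_n * 'I_m) modulus
      (\sum_(l : 'I_n * 'I_m) a k.1 l.1 k.2 l.2 *: (x l.1 l.2 : C^o)) ^+ 2.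
  by rewrite pair_bigA /=; apply: eq_bigr => k _; rewrite pair_bigA.
split=> h x; last have -> : x = (fun p => x (p.1, p.2)) by apply/funext => -[].
  (* Vectors indexed by pairs and doubly indexed families correspond by currying. *)
  by rewrite E pair_bigA; exact: (h (fun p => x p.1 p.2)).
by have := h (fun k i => x (k, i)); rewrite E pair_bigA.
Qed.

Lemma l2norm_e j : l2norm (e_ j : l2) = 1.
Proof.
apply/eqP; rewrite -(@eqrXn2 _ 2)// ?l2norm_ge0// expr1n; apply/eqP.
have := dotxx (e_ j : l2); rewrite dot_er e_E eqxx.
by move=> /(congr1 (@complex.Re R)).
Qed.

Lemma entry_le T i j : modulus (entry T i j) <= fine (opnorm T).
Proof.
apply: le_trans (modulus_coord _ _) _; apply: le_trans (l2norm_Bop _ _) _.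
by rewrite l2norm_e mulr1.
Qed.

(** Each $b$ is Hilbert-Schmidt and $|t_{ij}| \le \|T\|$, so $[t_{ij}b_{ij}]$ is again
    Hilbert-Schmidt and is the matrix of an operator. *)
Lemma schur_multiplier_ex T : exists M : S1 -> Bop, schur_multiplier T M.
Proof.
suff /boolp.choice[M MT] : forall b : S1, exists S : Bop,
    forall i j, entry S i j = entry T i j * entry b i j by exists M.
move=> b.
have [K bK] := trace_class_hilbert_schmidt (S1P b).
apply: (@hilbert_schmidt_operator _ _ _ (fine (opnorm T) ^+ 2 * K)) => A B.
apply: le_trans (ler_wpM2l (sqr_ge0 _) (bK A)).
rewrite mulr_sumr; apply: ler_sum => j _.
apply: le_trans (ler_wpM2l (sqr_ge0 _) (sum_sqr_modulus_le _ B)).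
rewrite mulr_sumr; apply: ler_sum => i _.
rewrite modulusM exprMn ler_wpM2r ?sqr_ge0//.
by rewrite ler_pXn2r ?nnegrE ?modulus_ge0 ?opnorm_ge0 ?entry_le.
Qed.

Lemma schur_multiplier_linear T (M : S1 -> Bop) :
  schur_multiplier T M -> linear_on_S1 M.
Proof.
move=> MT z b c d dE; apply: Bop_ext => i j; rewrite MT dE.
have entryD (S S' : Bop) : entry (z *: S + S') i j = z * entry S i j + entry S' i j by [].
by rewrite !entryD !MT mulrDr mulrCA.
Qed.

Definition matrix_unit (k l : I) (x : l2) : l2 := x l *: e_ k.

Lemma matrix_unit_bounded k l : matrix_unit k l \in bounded_operator (R := R) (I := I).
Proof.
apply: (@bounded_operatorP _ _ _ 1) => // [a x y|x].
  by rewrite /matrix_unit l2D l2Z scalerDl scalerA.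
by rewrite /matrix_unit l2normZ l2norm_e mulr1 mul1r modulus_coord.
Qed.

Definition unit_Bop k l : Bop := MkBop (matrix_unit_bounded k l).

Lemma entry_unit k l i j : entry (unit_Bop k l) i j = (l == j)%:R * (i == k)%:R.
Proof. by []. Qed.

(** The adjoint of $e_{kl}$ is $e_{lk}$ and $e_{lk}e_{kl} = e_{ll}$, so $|e_{kl}| = e_{ll}$. *)
Lemma unit_trace_class k l : trace_class (unit_Bop k l).
Proof.
exists (unit_Bop l l).
  split=> [x|]; first by rewrite dotZl dotC dot_er mul_conj_modulus lecR sqr_ge0.
  exists (unit_Bop l k) => [x y|x] /=.
    by rewrite dotZl dotZr dotC !dot_er mulrC.
  by rewrite /matrix_unit !l2Z !e_E !eqxx.
(* The diagonal of $e_{ll}$ coincides term by term with the series of the squared norm of $e_l$,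
   which is finite. *)
have := l2P (e_ l : l2); rewrite inE; congr (_ < _)%E; apply: eq_esum => i _.
rewrite entry_unit /= /unit_vector eq_sym.
by case: eqP => _; rewrite ?mulr1 ?mulr0 /= ?modulus0 ?expr0n// /modulus normr1 expr1n.
Qed.

Definition unit_S1 k l : S1 := MkS1 (unit_trace_class k l).

(** Every bracket evaluated below has a matrix unit on one side, hence a single possibly nonzero
    term, and both successive sums are eventually constant. *)
Lemma bracket_support1 T (b : S1) k l :
  (forall i j, (i != k) || (j != l) -> entry T i j * entry b i j = 0) ->
  bracket T b = entry T k l * entry b k l.
Proof.
move=> h; rewrite /bracket (@sum_support1 _ _ _ k) => [|i ik].
  by rewrite (@sum_support1 _ _ _ l) => [//|j jl]; rewrite h// jl orbT.
by rewrite (@sum_support1 _ _ _ l) => [|j _]; rewrite h// ik.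
Qed.

Lemma bracket_unit_S1 T k l : bracket T (unit_S1 k l) = entry T k l.
Proof.
rewrite (@bracket_support1 _ _ k l) => [|i j]; rewrite entry_unit ?eqxx ?mulr1//.
by rewrite [l == j]eq_sym => /orP[] /negPf ->; rewrite ?mulr0 ?mul0r ?mulr0.
Qed.

Lemma entry_scale_unit (a : C) k l i j :
  entry (a *: unit_Bop k l) i j = a * ((l == j)%:R * (i == k)%:R).
Proof. by []. Qed.

Lemma bracket_scale_unit (a : C) k l (b : S1) :
  bracket (a *: unit_Bop k l) b = a * entry b k l.
Proof.
rewrite (@bracket_support1 _ _ k l) => [|i j]; rewrite entry_scale_unit ?eqxx ?mulr1//.
by rewrite [l == j]eq_sym => /orP[] /negPf ->; rewrite ?mulr0 ?mul0r ?mulr0 ?mul0r.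
Qed.

(** Injectivity makes the vectors [e_ (f q)] orthonormal. *)
Lemma l2norm_sum_e (K : finType) (f : K -> I) (c : K -> C) : injective f ->
  l2norm (\sum_q c q *: e_ (f q) : l2) ^+ 2 = \sum_q modulus (c q) ^+ 2.
Proof.
move=> f_inj; set x : l2 := \sum_q _.
have xf q : x (f q) = c q.
  rewrite /x l2_sum (bigD1 q isT) l2Z e_E eqxx mulr1 big1 => [|p pq]; first exact: addr0.
  by rewrite l2Z e_E (inj_eq f_inj) eq_sym (negPf pq) mulr0.
have dot_suml (s : seq K) y : dot (\sum_(q <- s) c q *: e_ (f q)) y =
    \sum_(q <- s) c q * (y (f q))^*.
  elim: s => [|q s IH]; last by rewrite !big_cons dotDl IH dotZl dotC dot_er.
  by rewrite !big_nil -(scale0r 0) dotZl mul0r.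
have := dotxx x; rewrite {1}/x dot_suml.
under eq_bigr do rewrite xf mul_conj_modulus.
by rewrite -rmorph_sum => /(congr1 (@complex.Re R)).
Qed.

Lemma cvg_l2norm (g : {fset I} -> l2) y :
  (fun F => l2norm (y - g F)) @ totally --> (0 : R) ->
  (fun F => l2norm (g F)) @ totally --> l2norm y.
Proof.
move=> /cvgrPdist_le yg; apply/cvgrPdist_le => e /yg; apply: filterS => F.
rewrite sub0r normrN ger0_norm ?l2norm_ge0// => /(le_trans _); apply.
have h1 : l2norm (g F) <= l2norm y + l2norm (y - g F).
  by rewrite -[X in _ + X]l2normN; have := l2normD y (- (y - g F)); rewrite opprB subrKC.
have h2 : l2norm y <= l2norm (g F) + l2norm (y - g F).
  by have := l2normD (g F) (y - g F); rewrite subrKC.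
by rewrite ler_norml; apply/andP; split; lra.
Qed.

Lemma l2norm_trunc_le F x : l2norm (trunc F x) <= l2norm x.
Proof.
by rewrite -(@ler_pXn2r _ 2)// ?nnegrE ?l2norm_ge0// l2norm_trunc sum_sqr_modulus_le.
Qed.

Lemma truncB F x y : trunc F (x - y) = trunc F x - trunc F y.
Proof.
apply/val_inj/funext => i; rewrite [LHS]truncE [RHS]l2D l2N !truncE l2D l2N.
by case: ifP; rewrite ?subrr.
Qed.

(* The finite compressions of the operator matrix T converge strongly to T. *)
Lemma compression_le n (T : 'I_n -> 'I_n -> Bop) (c : R) :
  (forall F (x : 'I_n -> l2),
    \sum_k \sum_(i <- F) modulus (\sum_l \sum_(j <- F) entry (T k l) i j * x l j) ^+ 2
    <= c ^+ 2 * \sum_l \sum_(j <- F) modulus (x l j) ^+ 2) ->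
  forall x : 'I_n -> l2, \sum_k l2norm (\sum_l T k l (x l)) ^+ 2 <=
                         c ^+ 2 * \sum_k l2norm (x k) ^+ 2.
Proof.
move=> Tc x; pose Y k := \sum_l T k l (x l).
pose YF F k := \sum_l T k l (trunc F (x l)).
have cYF k : (fun F => l2norm (Y k - YF F k)) @ totally --> (0 : R).
  apply: (squeeze_cvgr (f := fun=> 0)
    (h := fun F => \sum_l l2norm (T k l (x l) - T k l (trunc F (x l))))).
  - near=> F; rewrite l2norm_ge0 /= /Y /YF -sumrB.
    elim/big_ind2 : _ => [|u r v s ur vs|//]; first by rewrite l2norm0.
    exact: le_trans (l2normD _ _) (lerD ur vs).
  - exact: cvg_cst.
  - rewrite [X in _ --> X](_ : 0 = \sum_(l < n) 0); last by rewrite big1.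
    by apply: cvg_sum_seq => l; exact: cvg_Bop_trunc.
(* Both the arguments and the values are truncated. The error splits into the truncation error of
   [Y k] and the truncation of [Y k - YF F k], and truncation is contractive. *)
have cT k : (fun F => l2norm (trunc F (YF F k))) @ totally --> l2norm (Y k).
  apply: cvg_l2norm; apply: (squeeze_cvgr (f := fun=> 0)
    (h := fun F => l2norm (Y k - trunc F (Y k)) + l2norm (Y k - YF F k))).
  - near=> F; rewrite l2norm_ge0 /=.
    have -> : Y k - trunc F (YF F k) = (Y k - trunc F (Y k)) + trunc F (Y k - YF F k).
      by rewrite truncB addrA subrK.
    by apply: le_trans (l2normD _ _) _; rewrite lerD2l l2norm_trunc_le.
  - exact: cvg_cst.
  - by rewrite -[X in _ --> X](addr0 0); apply: cvgD; [exact: cvg_trunc|exact: cYF].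
have cT2 : (fun F => \sum_k l2norm (trunc F (YF F k)) ^+ 2) @ totally -->
    \sum_k l2norm (Y k) ^+ 2.
  by apply: cvg_sum_seq => k; rewrite expr2; under eq_fun do rewrite expr2; exact: cvgM.
apply: (cvgr_to_le cT2); near=> F.
apply: (@le_trans _ _ (c ^+ 2 * \sum_l \sum_(j <- F) modulus (x l j) ^+ 2)).
  apply: le_trans (Tc F x); apply: ler_sum => k _; rewrite l2norm_trunc.
  apply: ler_sum => i _; rewrite /YF l2_sum.
  by under eq_bigr do rewrite Bop_trunc.
by rewrite ler_wpM2l ?sqr_ge0//; apply: ler_sum => l _; exact: sum_sqr_modulus_le.
Unshelve. all: by end_near. Qed.

End schur.

(** * Enumeration of a finite index set *)

Section fset_points.
Variables (I : choiceType) (F : {fset I}).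

(** Matrix norms are indexed by ordinals, so a matrix indexed by [F] is handled as one of order
    [size F] through this enumeration. *)
Definition pt (p : 'I_(size F)) : I := tnth (in_tuple F) p.

Lemma pt_inj : injective pt.
Proof.
move=> p q; rewrite /pt !(tnth_nth (pt p)) /= => /eqP.
by rewrite nth_uniq ?fset_uniq// => /eqP /val_inj.
Qed.

Lemma sum_pt (V : nmodType) (f : I -> V) : \sum_(i <- F) f i = \sum_p f (pt p).
Proof. by rewrite big_tnth. Qed.

End fset_points.

(** * The two inequalities for the completely bounded norm *)

Section schur_norm.
Variables (R : realType) (I : choiceType).
Local Notation C := R[i].
Local Notation l2 := (l2 R I).
Local Notation Bop := (Bop R I).
Local Notation S1 := (S1 R I).
Implicit Types (x y z : l2) (F : {fset I}) (T : Bop) (M : S1 -> Bop).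

(** The matrix $[c^{-1}t_{pq}e_{pq}]$ only reads the coordinate of $x_q$ at the point $q$.
    Collecting these into one vector $y$, its output has components $c^{-1}(Ty)_p e_p$, so the bound
    is that of $T$ on $y$. *)
Lemma Bop_norms_diagonal T F (c : R) : 0 < c -> fine (opnorm T) <= c ->
  (Bop_norms (\matrix_(p, q)
     (((c^-1)%:C%C * entry T (pt p) (pt q)) *: unit_Bop R (@pt I F p) (@pt I F q))) <= 1)%E.
Proof.
move=> c0 Tc; apply/(@Bop_norms_leP _ _ _ _ 1) => // x; rewrite expr1n mul1r.
pose y : l2 := \sum_q x q (pt q) *: e_ (@pt I F q).
have yE p : \sum_l (\matrix_(p, q) (((c^-1)%:C%C * entry T (pt p) (pt q)) *:
    unit_Bop R (@pt I F p) (@pt I F q))) p l (x l) = ((c^-1)%:C%C * T y (pt p)) *: e_ (pt p).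
  rewrite /y linear_sum l2_sum mulr_sumr scaler_suml; apply: eq_bigr => q _.
  rewrite mxE linearZ_LR l2Z -[LHS]/(_ *: (_ *: _)) scalerA.
  by rewrite -mulrA [entry T _ _ * _]mulrC.
under eq_bigr do rewrite yE l2normZ l2norm_e mulr1 modulusM modulus_re exprMn.
rewrite -mulr_sumr ger0_norm ?invr_ge0 ?(ltW c0)// exprVn ler_pdivrMl ?exprn_gt0//.
rewrite -(sum_pt F (fun i => modulus (T y i) ^+ 2)).
apply: le_trans (sum_sqr_modulus_le _ _) _.
apply: (@le_trans _ _ ((c * l2norm y) ^+ 2)).
  rewrite ler_pXn2r ?nnegrE ?mulr_ge0 ?l2norm_ge0 ?(ltW c0)//.
  by apply: le_trans (l2norm_Bop _ _) _; rewrite ler_wpM2r ?l2norm_ge0.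
rewrite exprMn ler_wpM2l ?sqr_ge0// l2norm_sum_e; last exact: pt_inj.
apply: ler_sum => p _.
by rewrite ler_pXn2r ?nnegrE ?modulus_ge0 ?l2norm_ge0 ?modulus_coord.
Qed.

Lemma Bop_norms_schur_le T M n (b : 'M[S1]_n) : schur_multiplier T M ->
  (S1_norms b <= 1)%E -> (Bop_norms (map_mx M b) <= opnorm T)%E.
Proof.
(* The margin [e] keeps [c] positive even when [T] is zero, so that dividing by it is allowed. *)
move=> MT b1; apply/lee_addgt0Pr => e e0; rewrite opnorm_fin -EFinD.
set c := fine (opnorm T) + e.
have cT : fine (opnorm T) <= c by rewrite lerDl ltW.
have c0 : 0 < c by rewrite ltr_wpDl ?opnorm_ge0.
apply/Bop_norms_leP; first exact: ltW.
apply: compression_le => F x.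
pose v : 'M[Bop]_(size F) := \matrix_(p, q)
  (((c^-1)%:C%C * entry T (pt p) (pt q)) *: unit_Bop R (@pt I F p) (@pt I F q)).
pose phi S := \matrix_(k < n, l < n) bracket S (b k l).
(* The hypothesis on [b] makes [phi] completely contractive, and [v] is in the unit ball; the image
   has the entries $c^{-1}t_{pq}(b_{kl})_{pq}$. *)
have /(@Mn_norms_leP _ _ _ _ _ ler01)/(_ (fun q l => x l (pt q))) :
    (Mn_norms (map_mx phi v) <= 1%:E)%E.
  apply: le_trans b1; apply: ereal_sup_ubound; exists (size F), v; split => //.
  exact: Bop_norms_diagonal.
(* In the image of [v] the points of [F] are the outer index and the size [n] is the inner one; the
   compression has them in the opposite order. *)
rewrite expr1n mul1r exchange_big [leRHS]exchange_big /=.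
under [in leRHS]eq_bigr do rewrite -(sum_pt F (fun i => modulus (x _ i) ^+ 2)).
move=> h; rewrite mulrC -ler_pdivrMr ?exprn_gt0// mulrC -exprVn.
apply: le_trans h; rewrite mulr_sumr; apply: ler_sum => k _.
rewrite sum_pt mulr_sumr; apply: ler_sum => p _.
have -> : c^-1 = modulus (c^-1)%:C%C by rewrite modulus_re ger0_norm// invr_ge0 ltW.
rewrite -exprMn -modulusM le_eqVlt; apply/orP; left; apply/eqP.
congr (modulus _ ^+ 2); rewrite mulr_sumr [RHS]exchange_big /=.
apply: eq_bigr => l _; rewrite sum_pt mulr_sumr; apply: eq_bigr => q _.
by rewrite !mxE bracket_scale_unit MT !mulrA.
Qed.

(** Pairing with $[e_{pq}]$ is the map $S \mapsto [s_{pq}]$, the compression to the coordinates in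
    [F]. A test family on [F] is lifted isometrically to vectors of $\ell^2_I$, and only the
    coordinates in [F] of the result are kept. *)
Lemma S1_norms_unit F :
  (S1_norms (\matrix_(p, q) unit_S1 R (@pt I F p) (@pt I F q)) <= 1)%E.
Proof.
apply: ge_ereal_sup => _ [n [v [v1 ->]]].
apply/(@Mn_norms_leP _ _ _ _ _ ler01) => X; rewrite expr1n mul1r.
pose x (l : 'I_n) : l2 := \sum_q X l q *: e_ (@pt I F q).
have xE l : l2norm (x l) ^+ 2 = \sum_q modulus (X l q) ^+ 2.
  by apply: l2norm_sum_e; exact: pt_inj.
have := (@Bop_norms_leP _ _ _ v _ ler01).1 v1 x; rewrite expr1n mul1r.
under [in leRHS]eq_bigr do rewrite xE.
apply: le_trans; apply: ler_sum => k _.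
apply: le_trans (sum_sqr_modulus_le _ F); rewrite sum_pt; apply: ler_sum => p _.
rewrite le_eqVlt; apply/orP; left; apply/eqP; congr (modulus _ ^+ 2).
rewrite l2_sum; apply: eq_bigr => l _; rewrite /x linear_sum l2_sum.
by apply: eq_bigr => q _; rewrite !mxE bracket_unit_S1 linearZ_LR l2Z mulrC.
Qed.

Lemma opnorm_le_schur T M (c : R) : schur_multiplier T M -> 0 <= c ->
  (cbnorm (@S1_norms R I) (@Bop_norms R I) M <= c%:E)%E -> (opnorm T <= c%:E)%E.
Proof.
move=> MT c0 Mc; apply: opnorm_le => // x.
(* The case of a one by one operator matrix, which reduces the bound to the finite compressions of
   [T]. *)
have TK : forall y : 'I_1 -> l2, \sum_(k < 1) l2norm (\sum_(l < 1) T (y l)) ^+ 2 <=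
                         c ^+ 2 * \sum_(k < 1) l2norm (y k) ^+ 2.
  apply: (@compression_le _ _ 1 (fun _ _ => T)) => F y; rewrite !big_ord1.
  pose b : 'M[S1]_(size F) := \matrix_(p, q) unit_S1 R (@pt I F p) (@pt I F q).
  (* The tuple $(y_q e_q)_q$ has the norm of the restriction of $y$ to [F], and $[t_{pq}e_{pq}]$
     maps it to the components of the compression of [T] applied to that restriction. *)
  have /(Bop_norms_leP _ c0)/(_ (fun q => y 0 (pt q) *: e_ (pt q))) :
      (Bop_norms (map_mx M b) <= c%:E)%E.
    apply: le_trans Mc; apply: ereal_sup_ubound; exists (size F), b; split => //.
    exact: S1_norms_unit.
  under [in leRHS]eq_bigr do rewrite l2normZ l2norm_e mulr1.
  rewrite -(sum_pt F (fun i => modulus (y 0 i) ^+ 2)); apply: le_trans.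
  rewrite sum_pt; apply: ler_sum => p _.
  have -> : \sum_q (map_mx M b) p q (y 0 (pt q) *: e_ (pt q)) =
      (\sum_q entry T (pt p) (pt q) * y 0 (@pt I F q)) *: e_ (pt p).
    rewrite scaler_suml; apply: eq_bigr => q _; rewrite !mxE.
    have -> : M (unit_S1 R (pt p) (pt q)) = entry T (pt p) (pt q) *: unit_Bop R (pt p) (pt q).
      apply: Bop_ext => i j; rewrite MT entry_scale_unit entry_unit.
      by do 2 case: eqP => [->|_]; rewrite ?mulr0 ?mul0r ?mulr0.
    rewrite linearZ_LR -[LHS]/(_ *: (_ *: (_ *: _))) e_E eqxx scale1r.
    by rewrite !scalerA mulrC.
  rewrite l2normZ l2norm_e mulr1 big_ord1 le_eqVlt; apply/orP; left; apply/eqP.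
  by rewrite sum_pt.
rewrite -(@ler_pXn2r _ 2)// ?nnegrE ?mulr_ge0 ?l2norm_ge0// exprMn.
by have := TK (fun=> x); rewrite !big_ord1.
Qed.

End schur_norm.

Theorem proposition4p45 (R : realType) (I : choiceType) (A : Bop R I) :
  exists M : S1 R I -> Bop R I,
    [/\ schur_multiplier A M, linear_on_S1 M,
        completely_bounded (@S1_norms R I) (@Bop_norms R I) M
      & cbnorm (@S1_norms R I) (@Bop_norms R I) M = opnorm A].
Proof.
have [M MA] := schur_multiplier_ex A; exists M.
have ub : (cbnorm (@S1_norms R I) (@Bop_norms R I) M <= opnorm A)%E.
  by apply: ge_ereal_sup => _ [n [b [b1 ->]]]; exact: Bop_norms_schur_le.
have cb0 : (0 <= cbnorm (@S1_norms R I) (@Bop_norms R I) M)%E.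
  apply: le_trans (block_norm_ge0 _) _; last first.
    (* A supremum of extended reals is nonnegative only if some competitor is; the empty matrix of
       units serves, also when [I] is empty. *)
    apply: ereal_sup_ubound; exists _, (\matrix_(p, q) unit_S1 R (pt p) (@pt I fset0 q)).
    by split; [exact: S1_norms_unit|reflexivity].
have cb_fin : cbnorm (@S1_norms R I) (@Bop_norms R I) M \is a fin_num.
  by rewrite ge0_fin_numE//; apply: le_lt_trans ub _; rewrite opnorm_fin ltry.
split=> //.
- exact: schur_multiplier_linear MA.
- by rewrite /completely_bounded -ge0_fin_numE.
- apply/eqP; rewrite eq_le ub /= -[leRHS]fineK//.
  (* The lower bound is applied with [c] equal to the completely bounded norm itself, which is now
     known to be finite. *)
  by apply: (opnorm_le_schur MA); rewrite ?fine_ge0 ?fineK.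
Qed.
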